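(* Let $N$ be a lattice of rank $3$ and let $\Delta$ be a complete ($3$-dimensional) fan in $N$. Suppose every $1$-dimensional cone $\rho\in\Delta$ is contained in at least four $2$-dimensional cones of $\Delta$. Then there exists a nontrivial integral conewise linear function on the fan $\Delta$.
   Context: A lattice $N$ is a free abelian group of finite rank; $M=\operatorname{Hom}(N,\mathbb{Z})$ and $N_{\mathbb{R}}=N\otimes_{\mathbb{Z}}\mathbb{R}$. A fan in $N$ is a finite collection of strongly convex rational polyhedral cones in $N_{\mathbb{R}}$, closed under taking faces, such that any two cones intersect in a common face; it is complete if the union of its cones is $N_{\mathbb{R}}$. An integral conewise linear function on $\Delta$ is a function $N_{\mathbb{R}}\to\mathbb{R}$ (on the support of $\Delta$) whose restriction to each cone $\sigma\in\Delta$ coincides with the restriction to $\sigma$ of a linear function given by an element of $M$. It is trivial if it is the restriction of a single global linear function on $N_{\mathbb{R}}$, and nontrivial otherwise. *)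

(* Defs.v *)
From HB Require Import structures.
From mathcomp Require Import all_boot all_order all_algebra.
From mathcomp Require Import all_classical reals.

Set Implicit Arguments.
Unset Strict Implicit.
Unset Printing Implicit Defensive.

Import Order.TTheory GRing.Theory Num.Theory.

Local Open Scope classical_set_scope.
Local Open Scope ring_scope.

Definition free_of_rank (N : zmodType) (n : nat) : Prop :=
  exists b : 'I_n -> N,
    bijective (fun c : {ffun 'I_n -> int} => \sum_i b i *~ c i).

(* [iota : N -> V] exhibits [V] as N_R, the tensor product of [N] with the
   reals over the integers, with [iota x] = x (x) 1. The tensor product is
   given by its universal property. *)
Definition is_realification (R : realType) (N : zmodType) (V : vectType R)
    (iota : {additive N -> V}) : Prop :=
  forall (W : lmodType R) (f : {additive N -> W}),
    (exists g : {linear V -> W}, forall x, g (iota x) = f x) /\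
    (forall g h : {linear V -> W},
      (forall x, g (iota x) = h (iota x)) -> g =1 h).

Section Fans.
Variables (R : realType) (N : zmodType) (V : vectType R).
Variable iota : {additive N -> V}.

Implicit Types (s t : set V) (D : set (set V)) (f : V -> R).

Definition cone_generated_by (k : nat) (v : 'I_k -> V) : set V :=
  [set x | exists2 c : 'I_k -> R,
     forall i, 0 <= c i & x = \sum_i c i *: v i].

Definition rational_polyhedral_cone s : Prop :=
  exists (k : nat) (v : 'I_k -> N), s = cone_generated_by (iota \o v).

Definition strongly_convex s : Prop := forall x, s x -> s (- x) -> x = 0.

Definition is_face t s : Prop :=
  exists2 u : {linear V -> R^o},
    forall x, s x -> 0 <= u x & t = s `&` [set x | u x = 0].

(* The dimension of a cone is that of its linear span, the smallest subspace
   containing it. *)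
Definition cone_dim s (d : nat) : Prop :=
  exists U : {vspace V},
    [/\ s `<=` [set` U],
        forall W : {vspace V}, s `<=` [set` W] -> (U <= W)%VS
      & \dim U = d].

Definition is_fan D : Prop :=
  [/\ finite_set D,
      forall s, D s -> rational_polyhedral_cone s /\ strongly_convex s,
      forall s t, D s -> is_face t s -> D t
    & forall s t, D s -> D t -> is_face (s `&` t) s /\ is_face (s `&` t) t].

Definition fan_support D : set V := \bigcup_(s in D) s.

Definition complete_fan D : Prop := is_fan D /\ fan_support D = setT.

Definition fan_cones D (d : nat) : set (set V) :=
  [set s | D s /\ cone_dim s d].

(* [g] is the R-linear extension to N_R of an element [m] of M = Hom(N, Z). *)
Definition given_by_M (g : {linear V -> R^o}) : Prop :=
  exists m : {additive N -> int}, forall x, g (iota x) = (m x)%:~R.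

(* Only the values of [f] on the support of [D] matter here and in
   [trivial_on]. *)
Definition integral_conewise_linear D f : Prop :=
  forall s, D s ->
    exists2 g : {linear V -> R^o}, given_by_M g & forall x, s x -> f x = g x.

Definition trivial_on D f : Prop :=
  exists g : {linear V -> R^o}, forall x, fan_support D x -> f x = g x.

End Fans.

(* Main.v *)
From HB Require Import structures.
From mathcomp Require Import all_boot all_order all_algebra.
From mathcomp Require Import all_classical reals.
From mathcomp Require Import ring lra zify.
Require Import Defs.

Set Implicit Arguments.
Unset Strict Implicit.
Unset Printing Implicit Defensive.

Import Order.TTheory GRing.Theory Num.Theory.

Local Open Scope classical_set_scope.
Local Open Scope ring_scope.

(** The theorem is a dimension count for a homogeneous linear system with
    integer coefficients.  Call a cone full when it spans the space.  Give every
    full cone [s] an unknown element [m_s] of M and every ray [r], spanned by a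
    lattice vector [v_r], an unknown value [h_r]; for every incidence [r] in [s]
    ask that [m_s (v_r) = h_r].  A solution glues to an integral conewise linear
    function, since two full cones meet in a common face and a form vanishing on
    the rays of that face vanishes on it ([vanishes_on_rays]).  Requiring in
    addition [m_s = 0] for one chosen full cone kills the global linear
    functions, so that any nonzero solution is nontrivial ([nontrivial_exists]).

    With [F] full cones, [Q] rays and [S] incidences there are [3 F + Q] unknowns
    and [S + 3] equations, so it remains to see that [S + 3 < 3 F + Q].  This
    would follow from Euler's formula on the sphere, but a double counting gives
    the needed inequality directly.  Choose a direction [w] outside the span of
    every cone that is not full, and look at an incidence [r] in [s].  Either [s]
    contains a point of [r] moved a little in the direction [w], or one moved in
    the direction [- w], or [r] lies on the silhouette of [s] seen along [w].  By
    genericity each ray has at most one incidence of each of the first two kinds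
    ([generic_cone_unique]).  The projection of [s] along [w] is a pointed plane
    cone unless [s] contains [w] or [- w], so [s] has at most two silhouette rays
    ([silhouette_le2]); the two distinct cones containing [w] and [- w] have
    none.  Hence [S <= 2 Q + 2 (F - 2)].  On the other hand [S >= 4 Q], because
    each ray is in at least four two-dimensional cones and, turning around the
    ray, each of these has its own full cone on its left ([left_cone],
    [left_cone_inj]).  Together the two inequalities give [S + 6 <= 3 F + Q].

    The convexity used comes from Gordan's theorem ([gordan]): a pointed finitely
    generated cone has a linear form positive on its nonzero vectors.  It yields
    separation from outside points, which replaces closedness, and the existence
    of enough one-dimensional faces. *)

(** * Properties holding for small positive parameters *)

Section Small.
Variable R : realType.

Definition small (P : R -> Prop) : Prop :=
  exists2 d, 0 < d & forall e, 0 < e -> e < d -> P e.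

Lemma small_ex (P : R -> Prop) : small P -> exists2 e, 0 < e & P e.
Proof.
move=> [d d0 h]; exists (d / 2); first by lra.
by apply: h; lra.
Qed.

Lemma small_all (T : eqType) (s : seq T) (P : T -> R -> Prop) :
  (forall t, t \in s -> small (P t)) ->
  small (fun e => forall t, t \in s -> P t e).
Proof.
elim: s => [|t s ih] h; first by exists 1.
have [d1 d10 h1] := h t (mem_head _ _).
have [|d2 d20 h2] := ih; first by move=> t' ts; apply: h; rewrite inE ts orbT.
exists (Num.min d1 d2); first by rewrite lt_min d10.
move=> e e0; rewrite lt_min => /andP[e1 e2] t'; rewrite inE => /predU1P[->|].
  exact: h1.
exact: h2.
Qed.

Lemma small_gt0 (a b : R) : 0 < a -> small (fun e => 0 < a + e * b).
Proof.
move=> a0; have b0 := normr_ge0 b.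
exists (a / (1 + `|b|)); first by rewrite divr_gt0 //; lra.
move=> e e0; rewrite ltr_pdivlMr; last by lra.
have := ler_norm (- b); rewrite normrN => hb hlt.
have : 0 <= e * (`|b| + b) by rewrite mulr_ge0 //; lra.
lra.
Qed.

Lemma small_neq0 (a b : R) : a != 0 -> small (fun e => a + e * b != 0).
Proof.
rewrite neq_lt => /orP[a0|a0].
  have [|d d0 h] := @small_gt0 (- a) (- b); first by lra.
  by exists d => // e e0 ed; rewrite lt_eqF //; move: (h e e0 ed); lra.
have [d d0 h] := @small_gt0 a b a0.
by exists d => // e e0 ed; rewrite gt_eqF //; exact: h.
Qed.

End Small.

(** * Linear forms and finitely generated cones *)

Section Cones.
Variables (R : realType) (V : vectType R).

Local Notation form := {linear V -> R^o}.
Implicit Types (u g m : form) (x y z v w : V) (s t : set V) (vs : seq V).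

(* Linearity with the operations of [R] in place of those of [R^o]. *)
Lemma formZ u (a : R) x : u (a *: x) = a * (u x : R) :> R.
Proof. by rewrite linearZ. Qed.

Lemma formD u x y : u (x + y) = (u x : R) + u y :> R.
Proof. exact: linearD. Qed.

Lemma ex_form (f : V -> R) :
  (forall a x y, f (a *: x + y) = a * f x + f y) -> exists u, forall x, u x = f x.
Proof.
move=> h.
pose L := GRing.isLinear.Build R V R^o *:%R (f : V -> R^o) h.
pose g : form := HB.pack (f : V -> R^o) L.
by exists g.
Qed.

Lemma form_neq0 z : z != 0 -> exists u, u z != 0.
Proof.
move=> z0.
have [[i hi]|h] := pselect (exists i, coord (vbasis {:V}) i z != 0); last first.
  move: z0; rewrite (coord_vbasis (memvf z)) big1 ?eqxx // => i _.
  have [->|hi] := eqVneq (coord (vbasis {:V}) i z) 0; first by rewrite scale0r.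
  by case: h; exists i.
have [|u hu] := @ex_form (coord (vbasis {:V}) i).
  by move=> a x y; rewrite linearP.
by exists u; rewrite hu.
Qed.

Definition is_cone s :=
  [/\ s 0, forall x y, s x -> s y -> s (x + y)
    & forall (a : R) x, 0 <= a -> s x -> s (a *: x)].

(** The recursive form makes adding a generator, the step of all inductions
    below, a definitional unfolding. *)
Fixpoint conic vs : set V :=
  if vs is v :: vs' then
    [set x | exists a : R, exists y, [/\ 0 <= a, conic vs' y & x = a *: v + y]]
  else [set 0].

Lemma conic_is_cone vs : is_cone (conic vs).
Proof.
elim: vs => [|v vs [h0 hD hZ]] /=.
  by split=> [//|x y -> ->|a x _ ->]; rewrite ?addr0 ?scaler0.
split.
- by exists 0, 0; rewrite scale0r addr0.
- move=> _ _ [a [y [a0 hy ->]]] [b [z [b0 hz ->]]].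
  exists (a + b), (y + z); split; [lra|exact: hD|].
  by rewrite scalerDl addrACA.
- move=> c _ c0 [a [y [a0 hy ->]]].
  exists (c * a), (c *: y); split; [exact: mulr_ge0|exact: hZ|].
  by rewrite scalerDr scalerA.
Qed.

Lemma conic0 vs : conic vs 0.
Proof. by case: (conic_is_cone vs). Qed.

Lemma conicD vs x y : conic vs x -> conic vs y -> conic vs (x + y).
Proof. by case: (conic_is_cone vs) => _ h _; exact: h. Qed.

Lemma conicZ vs (a : R) x : 0 <= a -> conic vs x -> conic vs (a *: x).
Proof. by case: (conic_is_cone vs) => _ _ h; exact: h. Qed.

Lemma conic_gen vs v : v \in vs -> conic vs v.
Proof.
elim: vs => //= v' vs ih; rewrite inE => /predU1P[->|/ih h].
  by exists 1, 0; rewrite ler01 scale1r addr0; split=> //; exact: conic0.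
by exists 0, v; rewrite scale0r add0r.
Qed.

Lemma conic_min s vs : is_cone s -> (forall v, v \in vs -> s v) -> conic vs `<=` s.
Proof.
move=> [s0 sD sZ]; elim: vs => [|v vs ih] h x /=; first by move=> ->.
move=> [a [y [a0 hy ->]]]; apply: sD.
  by apply: sZ => //; apply: h; rewrite mem_head.
by apply: ih => // v' hv'; apply: h; rewrite inE hv' orbT.
Qed.

Lemma conic_sub vs vs' : (forall v, v \in vs -> conic vs' v) ->
  conic vs `<=` conic vs'.
Proof. by apply: conic_min; exact: conic_is_cone. Qed.

Lemma conic_map (f : {linear V -> V}) vs x :
  conic (map f vs) x -> exists2 y, conic vs y & x = f y.
Proof.
elim: vs x => [|v vs ih] x /=; first by move=> ->; exists 0; rewrite ?linear0.
move=> [a [_ [a0 /ih[y hy ->] ->]]]; exists (a *: v + y); last by rewrite linearP.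
by exists a, y.
Qed.

Lemma conic_eq0 u vs : (forall v, v \in vs -> u v = 0) ->
  forall x, conic vs x -> u x = 0.
Proof.
move=> h; apply: (@conic_min [set x | u x = 0]) => //; split=> /=.
- by rewrite linear0.
- by move=> x y hx hy; rewrite linearD hx hy addr0.
- by move=> a x _ hx; rewrite formZ hx mulr0.
Qed.

Lemma conic_gt0 u vs : (forall v, v \in vs -> v != 0 -> 0 < u v) ->
  forall x, conic vs x -> x != 0 -> 0 < u x.
Proof.
move=> h x hx x0; suff : x = 0 \/ 0 < u x by case=> // /eqP; rewrite (negPf x0).
apply: (@conic_min [set x | x = 0 \/ 0 < u x]) hx => //; last first.
  by move=> v hv /=; have [->|v0] := eqVneq v 0; [left|right; exact: h].
split=> /=; first by left.
- move=> y z [->|hy] [->|hz]; rewrite ?addr0 ?add0r; auto.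
  by right; rewrite linearD addr_gt0.
- move=> a y a0 [->|hy]; first by left; rewrite scaler0.
  have [->|an0] := eqVneq a 0; first by left; rewrite scale0r.
  by right; rewrite formZ mulr_gt0 // lt_def an0.
Qed.

(** The projection killing [z] along the hyperplane [g = 0], when [g z = 1]. *)
Lemma ex_proj g z : exists P : {linear V -> V}, forall x, P x = x - (g x : R) *: z.
Proof.
have h : linear (fun x : V => x - (g x : R) *: z).
  move=> a x y; rewrite linearD formZ scalerDl scalerBr scalerA opprD.
  by rewrite addrACA.
pose L := GRing.isLinear.Build R V V *:%R (fun x : V => x - (g x : R) *: z) h.
pose P : {linear V -> V} := HB.pack (fun x : V => x - (g x : R) *: z) L.
by exists P.
Qed.

Lemma pointed_addr_eq0 s x y : strongly_convex s -> s x -> s y ->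
  x + y = 0 -> x = 0.
Proof.
move=> sc sx sy /eqP; rewrite addr_eq0 => /eqP e; apply: sc => //.
by rewrite e opprK.
Qed.

(** Gordan's theorem, by induction on the number of generators.  A form [u]
    that is positive on all generators but [z] can be corrected: if [u z < 0],
    project along [z] onto the kernel of [u]; this moves the other generators by
    nonnegative multiples of [z], hence inside the cone, so their projections
    still generate a pointed cone, to which induction applies. *)
Lemma gordan vs : strongly_convex (conic vs) ->
  exists u, forall x, conic vs x -> x != 0 -> 0 < u x.
Proof.
suff main n : forall vs, size vs = n -> strongly_convex (conic vs) ->
    exists u, forall x, conic vs x -> x != 0 -> 0 < u x by exact: main erefl.
elim: n {vs} => [|n ih] [|z vs] //=.
  by move=> _ _; have [|u _] := @ex_form (fun=> 0); [move=> *; ring|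
     exists u => x -> /eqP].
move=> [sz] sc.
have sub x : conic vs x -> conic (z :: vs) x.
  by move=> hx; exists 0, x; rewrite scale0r add0r.
have cz : conic (z :: vs) z by apply: conic_gen; rewrite mem_head.
have scvs : strongly_convex (conic vs) by move=> x /sub hx /sub; exact: sc.
have [z0|z0] := eqVneq z 0.
  have [u hu] := ih vs sz scvs; exists u => x [a [y [_ hy ->]]].
  by rewrite z0 scaler0 add0r; exact: hu.
suff [u [uz hu]] : exists u, 0 < u z /\ forall v, v \in vs -> v != 0 -> 0 < u v.
  exists u; apply: (@conic_gt0 _ (z :: vs)) => v.
  by rewrite inE => /predU1P[->//|]; exact: hu.
(* If [u z = 0], adding a small multiple of a form that is positive at [z] keeps
   the values on [vs] positive. *)
suff [u [uz hu]] : exists u, 0 <= u z /\ forall v, v \in vs -> v != 0 -> 0 < u v.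
  have [g gz] := form_neq0 z0.
  have [|d d0 hd] := @small_all R _ vs
     (fun v e => v != 0 -> 0 < u v + e * (Num.sg (g z : R) * g v)).
    move=> v hv; have [->|v0] := eqVneq v 0; first by exists 1.
    have [d d0 hd] := small_gt0 (Num.sg (g z : R) * g v) (hu v hv v0).
    by exists d => // e e0 ed _; exact: hd.
  have [|u' hu'] := @ex_form (fun x => u x + d / 2 * (Num.sg (g z : R) * g x)).
    by move=> a x y; rewrite !linearD !formZ; ring.
  exists u'; split; last first.
    by move=> v hv v0; rewrite hu'; apply: hd => //; lra.
  rewrite hu' -normrEsg ltr_wpDl // mulr_gt0 ?normr_gt0 //; lra.
have [u hu] := ih vs sz scvs.
have [uz|uz] := leP 0 (u z : R).
  by exists u; split=> // v hv; apply: hu; exact: conic_gen.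
have [|g hg] := @ex_form (fun x => (u z : R)^-1 * u x).
  by move=> a x y; rewrite linearD formZ; ring.
have [P hP] := ex_proj g z.
have uz0 : (u z : R) != 0 by rewrite lt_eqF.
have gz : g z = 1 by rewrite hg mulVf.
have gneg v : conic vs v -> g v <= 0.
  move=> hv; rewrite hg; have [->|v0] := eqVneq v 0.
    by rewrite linear0 mulr0.
  by rewrite nmulr_rle0 ?invr_lt0 // ltW // hu.
have Psub v : conic vs v -> conic (z :: vs) (P v).
  move=> hv; exists (- g v), v; split=> //; first by rewrite oppr_ge0 gneg.
  by rewrite hP addrC scaleNr.
have [||u' hu'] := ih (map P vs); first by rewrite size_map.
  move=> x /conic_map[y hy ->] /conic_map[y' hy' e].
  by apply: sc; [exact: Psub|rewrite e; exact: Psub].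
exists (u' \o P : {linear V -> R^o}); split=> /=.
  by rewrite hP gz scale1r subrr linear0.
move=> v hv v0; apply: hu'; first by apply: conic_gen; apply: map_f.
apply/negP => /eqP; rewrite hP => /eqP; rewrite subr_eq0 => /eqP ev.
have cv := conic_gen hv.
have : v = 0.
  apply: sc; first exact: sub.
  rewrite ev -scaleNr; by apply: (@conicZ (z :: vs)) => //; rewrite oppr_ge0 gneg.
by move/eqP; rewrite (negPf v0).
Qed.

(** When [x] is outside the cone, adding [- x] to the generators keeps the cone
    pointed, and Gordan's theorem applies to the larger cone. *)
Lemma conic_separation vs x : strongly_convex (conic vs) -> ~ conic vs x ->
  exists u, (forall y, conic vs y -> 0 <= u y) /\ u x < 0.
Proof.
move=> sc nx.
have [|u hu] := @gordan (- x :: vs).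
  move=> _ [a [y [a0 hy ->]]] [b [z [b0 hz e]]].
  have {}e : y + z = (a + b) *: x.
    move: e; rewrite !scalerN opprD opprK => e.
    have -> : z = (a *: x - y) + b *: x by rewrite e addrAC addNr add0r.
    by rewrite addrA [y + _]addrC subrK scalerDl.
  have [ab|ab] := ltP 0 (a + b).
    case: nx; have -> : x = (a + b)^-1 *: (y + z).
      by rewrite e scalerA mulVf ?scale1r // gt_eqF.
    by apply: conicZ; [rewrite invr_ge0 ltW|exact: conicD].
  have [a00 b00] : a = 0 /\ b = 0 by split; lra.
  move: e; rewrite a00 b00 addr0 !scale0r add0r => e.
  exact: pointed_addr_eq0 sc hy hz e.
have x0 : x != 0 by apply/eqP => x0; apply: nx; rewrite x0; exact: conic0.
exists u; split.
  move=> y hy; have [->|y0] := eqVneq y 0; first by rewrite linear0.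
  by apply/ltW/hu => //; exists 0, y; rewrite scale0r add0r.
have : 0 < u (- x).
  by apply: hu; rewrite ?oppr_eq0 //; apply: conic_gen; rewrite mem_head.
by rewrite linearN oppr_gt0.
Qed.
Lemma conic1P v x : conic [:: v] x <-> exists2 a : R, 0 <= a & x = a *: v.
Proof.
split=> [[a [_ [a0 -> ->]]]|[a a0 ->]]; first by exists a; rewrite ?addr0.
by exists a, 0; rewrite addr0.
Qed.

(** Modulo the line of [v] the other generators still span a pointed cone,
    because [v] is not one of their nonnegative combinations; a form given there
    by Gordan's theorem vanishes on the ray of [v] only. *)
Lemma extreme_ray_face v vs : strongly_convex (conic (v :: vs)) ->
  ~ conic vs v -> is_face (conic [:: v]) (conic (v :: vs)).
Proof.
move=> sc nv.
have v0 : v != 0 by apply/eqP => v0; apply: nv; rewrite v0; exact: conic0.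
have sub x : conic vs x -> conic (v :: vs) x.
  by move=> hx; exists 0, x; rewrite scale0r add0r.
have cv : conic (v :: vs) v by apply: conic_gen; rewrite mem_head.
have key x a : conic vs x -> x = a *: v -> x = 0.
  move=> hx e; have [a0|a0] := ltP 0 a.
    case: nv; have -> : v = a^-1 *: x by rewrite e scalerA mulVf ?scale1r ?gt_eqF.
    by apply: conicZ => //; rewrite invr_ge0 ltW.
  apply: sc; first exact: sub.
  by rewrite e -scaleNr; apply: (@conicZ (v :: vs)) => //; rewrite oppr_ge0.
have [g0 g0v] := form_neq0 v0.
have [|g hg] := @ex_form (fun x => (g0 v : R)^-1 * g0 x).
  by move=> a x y; rewrite linearD formZ; ring.
have gv : g v = 1 by rewrite hg mulVf.
have [P hP] := ex_proj g v.
have [|u hu] := @gordan (map P vs).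
  move=> _ /conic_map[x hx ->] /conic_map[y hy e].
  have exy : x + y = (g x + g y) *: v.
    move: e; rewrite !hP opprB => e.
    have {1}-> : y = (g x *: v - x) + g y *: v by rewrite e subrK.
    by rewrite addrA [x + _]addrC subrK scalerDl.
  have xy0 := key _ _ (conicD hx hy) exy.
  have -> : x = 0.
    exact: pointed_addr_eq0 sc (sub _ hx) (sub _ hy) xy0.
  by rewrite linear0.
have uP x : conic vs x -> 0 <= u (P x) /\ (u (P x) = 0 -> x = 0).
  move=> hx; have [e|Px0] := eqVneq (P x) 0.
    split=> [|_]; first by rewrite e linear0.
    by apply: (@key _ (g x)) => //; apply/eqP; rewrite -subr_eq0 -hP e.
  have h : 0 < u (P x).
    apply: hu => //; elim: {+}vs x hx {Px0} => [|w ws ih] x /=.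
      by move=> ->; rewrite linear0.
    by move=> [a [y [a0 hy ->]]]; exists a, (P y); split=> //; [exact: ih|rewrite linearP].
  by split=> [|e]; [exact: ltW|rewrite e ltxx in h].
have UE (a : R) y : u (P (a *: v + y)) = u (P y).
  by congr (u _); rewrite linearP hP gv scale1r subrr scaler0 add0r.
exists (u \o P : {linear V -> R^o}).
  by move=> _ [a [y [a0 hy ->]]] /=; rewrite UE; apply: (uP _ _).1.
apply/seteqP; split=> x /=.
  move=> /conic1P[a a0 ->]; split.
    by exists a, 0; rewrite addr0; split=> //; exact: conic0.
  by rewrite -[a *: v]addr0 UE !linear0.
move=> [[a [y [a0 hy ->]]]]; rewrite UE => /(uP _ hy).2 ->.
by apply/conic1P; exists a; rewrite ?addr0.
Qed.

(** Generators that are combinations of the others can be dropped; once none is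
    left, each generator spans a face. *)
Lemma form_eq0_on_rays vs m : strongly_convex (conic vs) ->
  (forall v, v \in vs -> v != 0 -> is_face (conic [:: v]) (conic vs) -> m v = 0) ->
  forall x, conic vs x -> m x = 0.
Proof.
suff main n : forall vs, (size vs <= n)%N -> strongly_convex (conic vs) ->
    (forall v, v \in vs -> v != 0 -> is_face (conic [:: v]) (conic vs) -> m v = 0) ->
    forall x, conic vs x -> m x = 0 by exact: main (leqnn _).
elim: n {vs} => [|n ih] vs.
  by rewrite leqn0 => /nilP -> _ _ x ->; rewrite linear0.
move=> sz sc h.
have rem_sub v w : w \in rem v vs -> w \in vs by move/mem_rem.
have [[v [vvs hv]]|nred] := pselect (exists v, v \in vs /\ conic (rem v vs) v).
  have e : conic (rem v vs) = conic vs.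
    apply/seteqP; split; apply: conic_sub => w hw; first exact/conic_gen/rem_sub/hw.
    have [->//|wv] := eqVneq w v; apply: conic_gen.
    by have := perm_mem (perm_to_rem vvs) w; rewrite hw inE (negPf wv) /= => <-.
  rewrite -e; apply: ih; rewrite ?e //.
    by rewrite size_rem // -subn1 leq_subLR add1n.
  by move=> w hw; apply: h; exact: rem_sub hw.
have mv v : v \in vs -> m v = 0.
  move=> hv; have [->|v0] := eqVneq v 0; first by rewrite linear0.
  have e : conic (v :: rem v vs) = conic vs.
    have pm := perm_mem (perm_to_rem hv).
    by apply/seteqP; split; apply: conic_sub => w hw; apply: conic_gen;
      rewrite ?pm // -pm.
  apply: h => //; rewrite -e; apply: extreme_ray_face; rewrite ?e //.
  by move=> hr; apply: nred; exists v.
exact: conic_eq0 mv.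
Qed.

Lemma cone_generatedE k (v : 'I_k -> V) :
  cone_generated_by v = conic [seq v i | i <- enum 'I_k].
Proof.
apply/seteqP; split=> x.
  move=> [c c0 ->]; apply: (@big_ind _ (conic _)); first exact: conic0.
    by move=> y z; exact: conicD.
  move=> i _; apply: conicZ => //; apply: conic_gen; apply: map_f.
  by rewrite mem_enum.
apply: conic_min; last first.
  move=> _ /mapP[i _ ->]; exists (fun j => (j == i)%:R) => [j|]; first by rewrite ler0n.
  by rewrite (bigD1 i) //= eqxx scale1r big1 ?addr0 // => j /negPf ->; rewrite scale0r.
split=> /=.
- by exists (fun=> 0) => //; rewrite big1 // => i _; rewrite scale0r.
- move=> _ _ [c c0 ->] [d d0 ->]; exists (fun i => c i + d i) => [i|].
    exact: addr_ge0.
  by rewrite -big_split; apply: eq_bigr => i _; rewrite scalerDl.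
- move=> a _ a0 [c c0 ->]; exists (fun i => a * c i) => [i|]; first exact: mulr_ge0.
  by rewrite scaler_sumr; apply: eq_bigr => i _; rewrite scalerA.
Qed.

(** The sum of the generators is a relative interior point: a form that is
    nonnegative on the cone and zero at the sum is zero at each generator. *)
Lemma conic_relint vs : exists2 p, conic vs p &
  forall t, is_face t (conic vs) -> t p -> t = conic vs.
Proof.
exists (\sum_(v <- vs) v).
  by rewrite big_seq; apply: big_ind; [exact: conic0|move=> ? ?; exact: conicD|
    move=> v; exact: conic_gen].
move=> t [u u0 ->] [_ /=]; rewrite linear_sum big_seq => /eqP.
rewrite psumr_eq0 => [|v hv]; last exact/u0/conic_gen.
move=> /allP h; apply/seteqP; split=> [x []//|x hx]; split=> //=.
apply: conic_eq0 hx => v hv.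
by move: (h v hv); rewrite hv => /eqP.
Qed.

End Cones.

(** * Lattice coordinates *)

(** The coordinates of the lattice extend to the real space by the existence part
    of the universal property; its uniqueness part, applied to the identity,
    shows that they determine a vector. *)
Lemma lattice_coordinates (R : realType) (N : zmodType) (n : nat)
    (V : vectType R) (iota : {additive N -> V}) :
  free_of_rank N n -> is_realification iota ->
  exists (e : 'I_n -> {additive N -> int}) (c : 'I_n -> {linear V -> R^o})
         (B : 'I_n -> V),
    [/\ forall k x, c k (iota x) = (e k x)%:~R,
        forall k j, c k (B j) = (k == j)%:R
      & forall x, x = \sum_k c k x *: B k].
Proof.
move=> [b [G GK KG]] hR.
pose F (x : {ffun 'I_n -> int}) := \sum_i b i *~ x i.
change (cancel F G) in GK; change (cancel G F) in KG.
have FD : {morph F : x y / x - y}.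
  move=> x y; rewrite /F -sumrB; apply: eq_bigr => i _.
  by rewrite !ffunE mulrzBr.
have GB : {morph G : x y / x - y}.
  by move=> x y; rewrite -[RHS]GK FD !KG.
have eB k : {morph (fun x => G x k) : x y / x - y} by move=> x y; rewrite GB !ffunE.
pose e k : {additive N -> int} :=
  HB.pack (fun x => G x k) (GRing.isZmodMorphism.Build N int _ (eB k)).
have eb k j : e k (b j) = (k == j)%:R.
  have -> : b j = F [ffun i => (i == j)%:R].
    rewrite /F (bigD1 j) //= ffunE eqxx mulr1z big1 ?addr0 // => i /negPf ij.
    by rewrite ffunE ij.
  by rewrite /e /= GK ffunE.
have /choice[c hc] k : exists u : {linear V -> R^o}, forall x, u (iota x) = (e k x)%:~R.
  have mB : {morph (fun x => (e k x)%:~R : R^o) : x y / x - y}.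
    by move=> x y; rewrite raddfB intrB.
  pose f : {additive N -> R^o} :=
    HB.pack (fun x => (e k x)%:~R : R^o) (GRing.isZmodMorphism.Build N R^o _ mB).
  by have [[g hg] _] := hR R^o f; exists g => x; rewrite hg.
exists e, c, (fun j => iota (b j)); split=> // [k j|x].
  by rewrite hc eb; case: eqP.
have hl : linear (fun x => \sum_k (c k x : R) *: iota (b k)).
  move=> a y z; rewrite scaler_sumr -big_split; apply: eq_bigr => k _.
  by rewrite linearD formZ scalerDl scalerA.
pose g : {linear V -> V} := HB.pack (fun x => \sum_k (c k x : R) *: iota (b k))
  (GRing.isLinear.Build R V V *:%R _ hl).
have [_ /(_ idfun g) h] := hR V iota.
apply: h => y /=; rewrite -[y in LHS]KG /F raddf_sum; apply: eq_bigr => k _.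
by rewrite hc raddfMz -scaler_int.
Qed.

(** * The determinant in a three-dimensional space *)

Section Det.
Let i0 : 'I_3 := Ordinal (isT : (0 < 3)%N).
Let i1 : 'I_3 := Ordinal (isT : (1 < 3)%N).
Let i2 : 'I_3 := Ordinal (isT : (2 < 3)%N).

Variables (R : realType) (V : vectType R).
Local Notation form := {linear V -> R^o}.
Variables (c : 'I_3 -> form) (B : 'I_3 -> V).
Hypothesis cB : forall k j, c k (B j) = (k == j)%:R.
Hypothesis Bc : forall x, x = \sum_k c k x *: B k.
Implicit Types (x y z n : V).

Definition det3 x y z : R :=
  let c0 v : R := c i0 v in
  let c1 v : R := c i1 v in
  let c2 v : R := c i2 v in
  c0 x * (c1 y * c2 z - c2 y * c1 z)
  - c1 x * (c0 y * c2 z - c2 y * c0 z)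
  + c2 x * (c0 y * c1 z - c1 y * c0 z).

Lemma coord_inj x y : (forall k, c k x = c k y :> R) -> x = y.
Proof.
by move=> h; rewrite [x]Bc [y]Bc; apply: eq_bigr => k _; rewrite h.
Qed.

Lemma forall_I3 (P : 'I_3 -> Prop) :
  P i0 -> P i1 -> P i2 -> forall k, P k.
Proof.
move=> h0 h1 h2 [[|[|[|//]]] i].
- by have -> : Ordinal i = i0 by exact: val_inj.
- by have -> : Ordinal i = i1 by exact: val_inj.
- by have -> : Ordinal i = i2 by exact: val_inj.
Qed.

Lemma cramer x y n z : det3 x y n *: z =
  det3 z y n *: x + det3 x z n *: y + det3 x y z *: n.
Proof.
apply: coord_inj; apply: forall_I3; rewrite !formD !formZ /det3; ring.
Qed.

Lemma det_form x y : exists u : form, forall z, u z = det3 x y z.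
Proof.
by apply: ex_form => a z z'; rewrite /det3 !(formD (c _)) !(formZ (c _)); ring.
Qed.

Lemma det3C x y z : det3 x z y = - det3 x y z.
Proof. rewrite /det3; ring. Qed.

Lemma det3_span x y (a b : R) : det3 x y (a *: x + b *: y) = 0.
Proof. by rewrite /det3 !(formD (c _)) !(formZ (c _)); ring. Qed.

(** If the cross product of [x] and [y] vanished, [y] would be the multiple of
    [x] read off from a nonzero coordinate of [x]. *)
Lemma det_pos x y : x != 0 -> (forall a : R, y <> a *: x) -> exists n, 0 < det3 x y n.
Proof.
move=> x0 hy; apply: contrapT => hn.
have h n : det3 x y n = 0.
  apply/eqP; rewrite eq_le; apply/andP; split; rewrite leNgt; apply/negP => h.
    by apply: hn; exists n.
  apply: hn; exists (- n); move: h; rewrite /det3 !(linearN (c _)); lra.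
have h0 := h (B i0); have h1 := h (B i1); have h2 := h (B i2).
rewrite /det3 !cB /= in h0 h1 h2.
have [k hk] : exists k, c k x != 0.
  apply: contrapT => hk; move/eqP: x0; apply; apply: coord_inj => k.
  by rewrite linear0; apply/eqP/negPn/negP => hk'; apply: hk; exists k.
apply: (hy ((c k y : R) / c k x)); apply: coord_inj => j; rewrite formZ.
apply: (mulfI hk); rewrite [RHS]mulrA mulrCA mulfV // mulr1.
by move: k j {hk}; apply: forall_I3; apply: forall_I3; lra.
Qed.

Lemma det0_span x y z : x != 0 -> (forall a : R, y <> a *: x) ->
  det3 x y z = 0 -> exists a b : R, z = a *: x + b *: y.
Proof.
move=> x0 hy hz; have [n hn] := det_pos x0 hy.
exists ((det3 x y n)^-1 * det3 z y n), ((det3 x y n)^-1 * det3 x z n).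
rewrite -!scalerA -scalerDr; have := cramer x y n z.
rewrite hz scale0r addr0 => <-; by rewrite scalerA mulVf ?scale1r // gt_eqF.
Qed.

End Det.

(** * Full-dimensional cones and rays of a complete fan *)

Section Full.
Variables (R : realType) (V : vectType R).
Local Notation form := {linear V -> R^o}.
Implicit Types (u : form) (x y z w p n : V) (s t r : set V).

Definition vanishes u s : Prop := forall x, s x -> u x = 0.

Definition full s : Prop := forall u, vanishes u s -> forall x, u x = 0.

Definition generic (D : set (set V)) w : Prop :=
  forall s, D s -> ~ full s -> exists2 u, vanishes u s & u w != 0.

Lemma not_full s : ~ full s -> exists u z, vanishes u s /\ u z != 0.
Proof.
move=> nf; apply: contrapT => h; apply: nf => u us z.
by apply/eqP/negPn/negP => uz; apply: h; exists u, z.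
Qed.

(** The forms already found are nonzero at [w]; a small displacement of [w] keeps
    them so and makes one more form nonzero. *)
Lemma generic_exists (D : set (set V)) : finite_set D -> exists w, generic D w.
Proof.
move=> /finite_seqP[ss ->]; elim: ss => [|s ss [w hw]]; first by exists 0.
have [fs|nfs] := pselect (full s).
  by exists w => t /=; rewrite inE => /predU1P[->//|ht]; exact: hw.
have [u0 [z [u0s u0z]]] := not_full nfs.
have [|e e0 he] := small_ex (@small_all R _ (s :: ss) (fun t e => ~ full t ->
    exists2 u, vanishes u t & u (w + e *: z) != 0) _); last first.
  by exists (w + e *: z) => t /= ht; exact: he.
move=> t; rewrite inE => /predU1P[->|ht].
  have [uw|uw] := eqVneq (u0 w : R) 0.
    exists 1 => // e e0 _ _; exists u0 => //.
    by rewrite formD formZ uw add0r mulf_neq0 // gt_eqF.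
  have [d d0 hd] := small_neq0 (u0 z : R) uw.
  exists d => // e e0 ed _; exists u0 => //.
  by rewrite formD formZ; exact: hd.
have [ft|nft] := pselect (full t); first by exists 1.
have [u ut uw] := hw t ht nft.
have [d d0 hd] := small_neq0 (u z : R) uw.
exists d => // e e0 ed _; exists u => //.
by rewrite formD formZ; exact: hd.
Qed.

Lemma genericN D w : generic D w -> generic D (- w).
Proof.
move=> hw s Ds nf; have [u us uw] := hw s Ds nf.
by exists u => //; rewrite linearN oppr_eq0.
Qed.

Lemma full_face s t : is_face t s -> full t -> t = s.
Proof.
move=> [u u0 ->] ft; apply/seteqP; split=> [x []//|x sx]; split=> //.
by apply: ft => y [].
Qed.

Lemma cone_segment s x w (e d : R) : is_cone s -> s x -> s (x + e *: w) ->
  0 <= d -> d <= e -> s (x + d *: w).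
Proof.
move=> [_ sD sZ] sx sxe d0 de.
have [e0|e0] := eqVneq e 0.
  by rewrite (_ : d = e) //; lra.
have ep : 0 < e by rewrite lt_def e0 /=; lra.
have -> : x + d *: w = (1 - d / e) *: x + (d / e) *: (x + e *: w).
  rewrite scalerDr scalerA divfK // addrA -scalerDl subrK scale1r //.
apply: sD; apply: sZ => //; last by rewrite divr_ge0 // ltW.
by rewrite subr_ge0 ler_pdivrMr // mul1r.
Qed.

Lemma ray_dim (v : V) : v != 0 -> cone_dim (conic [:: v]) 1.
Proof.
move=> v0; exists <[v]>%VS; split.
- by move=> x /conic1P[a _ ->] /=; rewrite memvZ // memv_line.
- by move=> W h; rewrite -memvE; apply: h; apply/conic1P; exists 1; rewrite ?scale1r.
- by rewrite dim_vline v0.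
Qed.

Lemma ray_eq (v w : V) : v != 0 -> conic [:: w] v -> conic [:: v] = conic [:: w].
Proof.
move=> v0 /conic1P[a a0 e].
have an0 : a != 0 by apply: contraNneq v0 => a00; rewrite e a00 scale0r.
apply/seteqP; split=> _ /conic1P[b b0 ->]; apply/conic1P.
  by exists (b * a); rewrite ?mulr_ge0 // e scalerA.
exists (b / a); first by rewrite divr_ge0.
by rewrite e scalerA divfK.
Qed.

End Full.

Section Fan.
Variables (R : realType) (N : zmodType) (V : vectType R) (iota : {additive N -> V}).
Local Notation form := {linear V -> R^o}.
Implicit Types (u : form) (x y z w p n : V) (s t r : set V).

Variable D : set (set V).
Hypothesis fanD : is_fan iota D.

Lemma fan_gen s : D s -> exists ns : seq N, s = conic (map iota ns).
Proof.
move=> Ds; have [_ /(_ s Ds)[[k [v ->]] _] _ _] := fanD.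
exists [seq v i | i <- enum 'I_k]; rewrite cone_generatedE; congr conic.
by elim: (enum 'I_k) => //= i l ->.
Qed.

Lemma fan_pointed s : D s -> strongly_convex s.
Proof. by move=> Ds; have [_ /(_ s Ds)[]] := fanD. Qed.

Lemma fan_cone s : D s -> is_cone s.
Proof. by move=> /fan_gen[vs ->]; exact: conic_is_cone. Qed.

Lemma fan_face s t : D s -> D t -> t `<=` s -> is_face t s.
Proof.
move=> Ds Dt ts; have [_ _ _ /(_ s t Ds Dt)[+ _]] := fanD.
by rewrite (setIidr ts).
Qed.

Lemma fanI s t : D s -> D t -> D (s `&` t).
Proof.
move=> Ds Dt; have [_ _ h /(_ s t Ds Dt)[h' _]] := fanD; exact: h Ds h'.
Qed.

Lemma fan_faceI s t : D s -> D t -> is_face (s `&` t) s.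
Proof. by move=> Ds Dt; have [_ _ _ /(_ s t Ds Dt)[]] := fanD. Qed.

Lemma fan_relint s : D s -> exists2 p, s p &
  forall t, D t -> t p -> s `<=` t.
Proof.
move=> Ds; have [vs e] := fan_gen Ds; have [p] := conic_relint (map iota vs).
rewrite -e => sp h; exists p => // t Dt tp.
by have <- := h _ (fan_faceI Ds Dt) (conj sp tp) => x [].
Qed.

Lemma ray_gen r : fan_cones D 1 r ->
  exists2 n : N, iota n != 0 & r = conic [:: iota n].
Proof.
move=> [Dr [U [rU Umin dU]]]; have [ns e] := fan_gen Dr.
have [[n nns n0]|h] := pselect (exists2 n, n \in ns & iota n != 0); last first.
  suff : (U <= 0)%VS by move=> /dimvS; rewrite dU dimv0.
  apply: Umin => x; rewrite e => hx /=; rewrite memv0; apply/eqP.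
  apply: (@conic_min _ _ [set 0]) hx => //.
    by split=> [//|y z -> ->|a y _ ->]; rewrite ?addr0 ?scaler0.
  move=> _ /mapP[n nns ->] /=; apply/eqP/negPn/negP => n0.
  by apply: h; exists n.
have rn : r (iota n) by rewrite e; apply: conic_gen; exact: map_f.
exists n => //.
have UE : U = <[iota n]>%VS.
  apply/esym/eqP; rewrite eqEdim dU dim_vline n0 /= andbT -memvE; exact: rU.
have [_ rD rZ] := fan_cone Dr.
apply/seteqP; split=> x.
  move=> rx; have : x \in U by exact: rU.
  rewrite UE => /vlineP[a ex]; apply/conic1P.
  have [a0|a0] := leP 0 a; first by exists a.
  exists 0 => //; rewrite scale0r; apply: (fan_pointed Dr) => //.
  by rewrite ex -scaleNr; apply: rZ => //; rewrite oppr_ge0 ltW.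
by move=> /conic1P[a a0 ->]; exact: rZ.
Qed.

(** A cone missing [p] is separated from it by a form, hence misses the points
    [p + e n] for all small [e > 0]; but these points are covered. *)
Lemma fan_cover_direction p n : fan_support D = setT ->
  exists s (e : R), [/\ D s, s p, 0 < e & s (p + e *: n)].
Proof.
move=> cover; have [fin _ _ _] := fanD.
have [ss ess] := (finite_seqP _).1 fin.
apply: contrapT => h.
have [|e e0 he] := small_ex (@small_all R _ ss (fun s e => ~ s (p + e *: n)) _).
  move=> s hs; have Ds : D s by rewrite ess.
  have [sp|nsp] := pselect (s p).
    by exists 1 => // e e0 _ spe; apply: h; exists s, e.
  have [ns es] := fan_gen Ds.
  have [||u [us up]] := @conic_separation R V (map iota ns) p; rewrite -?es //.
    exact: fan_pointed.
  rewrite -oppr_gt0 in up.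
  have [d d0 hd] := small_gt0 (- u n : R) up.
  exists d => // e e0 ed spe; have := hd e e0 ed.
  by have := us (p + e *: n); rewrite -es => /(_ spe); rewrite formD formZ; lra.
have : fan_support D (p + e *: n) by rewrite cover.
by move=> [s Ds]; apply: he; move: Ds; rewrite ess.
Qed.

(** Both cones contain the start of the segment from [x] in the direction [w], so
    a form vanishing on their intersection vanishes at [w]; by genericity the
    intersection is full, and a full face of a cone is the whole cone. *)
Lemma generic_cone_unique w s t x (e d : R) : generic D w ->
  D s -> D t -> s x -> t x -> 0 < e -> 0 < d ->
  s (x + e *: w) -> t (x + d *: w) -> s = t.
Proof.
move=> gw Ds Dt sx tx e0 d0 sxe txd.
pose m := Num.min e d; have m0 : 0 < m by rewrite lt_min e0.
have sm : s (x + m *: w).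
  by apply: cone_segment sxe _ _ => //; [exact: fan_cone|exact: ltW|rewrite ge_min lexx].
have tm : t (x + m *: w).
  by apply: cone_segment txd _ _ => //; [exact: fan_cone|exact: ltW|rewrite ge_min lexx orbT].
have [f|nf] := pselect (full (s `&` t)).
  rewrite -(full_face (fan_faceI Ds Dt) f) setIC; apply: full_face.
    exact: fan_faceI.
  by rewrite setIC.
have [u ust /eqP[]] := gw _ (fanI Ds Dt) nf.
have := ust _ (conj sm tm); rewrite formD formZ (ust x) // add0r => /eqP.
by rewrite mulf_eq0 gt_eqF //= => /eqP.
Qed.

Lemma generic_full w s x (e : R) : generic D w -> D s -> s x -> e != 0 ->
  s (x + e *: w) -> full s.
Proof.
move=> gw Ds sx e0 sxe; apply: contrapT => nf.
have [u us /eqP[]] := gw _ Ds nf.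
have := us _ sxe; rewrite formD formZ us // add0r => /eqP.
by rewrite mulf_eq0 (negPf e0) => /eqP.
Qed.

(** Move a relative interior point of [s] a little in a generic direction. *)
Lemma fan_in_full s : fan_support D = setT -> D s ->
  exists t, [/\ D t, full t & s `<=` t].
Proof.
move=> cover Ds; have [p sp hp] := fan_relint Ds.
have [fin _ _ _] := fanD; have [w gw] := generic_exists fin.
have [t [e [Dt tp e0 tpe]]] := fan_cover_direction p w cover.
exists t; split=> //; last exact: hp.
by apply: generic_full gw Dt tp _ tpe; rewrite gt_eqF.
Qed.

Lemma vanishes_on_rays s u : D s ->
  (forall r, fan_cones D 1 r -> r `<=` s -> vanishes u r) -> vanishes u s.
Proof.
move=> Ds h; have [ns e] := fan_gen Ds; rewrite e.
apply: form_eq0_on_rays; first by rewrite -e; exact: fan_pointed.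
rewrite -e => v hv v0 face.
have vr : conic [:: v] v by apply/conic1P; exists 1; rewrite ?scale1r.
apply: (h (conic [:: v])) vr; last first.
  by move: face => [g _ ->] x [].
split; last exact: ray_dim.
by have [_ _ hf _] := fanD; exact: hf Ds face.
Qed.

End Fan.

Lemma two_signs (R : realType) (a1 a2 a3 : R) :
  a1 < 0 /\ (a2 < 0 \/ a3 < 0) \/ a2 < 0 /\ a3 < 0 ->
  - a1 < 0 /\ (- a2 < 0 \/ - a3 < 0) \/ - a2 < 0 /\ - a3 < 0 -> False.
Proof. by case=> [[? [?|?]]|[? ?]]; case=> [[? [?|?]]|[? ?]]; lra. Qed.

(** * Silhouettes of a cone *)

Section Silhouette.
Variables (R : realType) (V : vectType R).
Implicit Types (x w : V) (s r : set V).

(** For [x] in the cone [s], this says that the line through [x] parallel to [w]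
    meets [s] in [x] only. *)
Definition silhouette w s x : Prop := forall e : R, e != 0 -> ~ s (x + e *: w).

Variables (w : V) (s : set V).
Hypotheses (cs : is_cone s) (ps : strongly_convex s).
Hypotheses (nw : ~ s w) (nNw : ~ s (- w)).

Lemma notin_line (t : R) : s (t *: w) -> t = 0.
Proof.
have [_ _ sZ] := cs; move=> st; apply/eqP; rewrite eq_le !leNgt.
apply/andP; split; apply/negP => t0.
  apply: nw; rewrite -[w]scale1r -(mulVf (lt0r_neq0 t0)) -scalerA.
  by apply: sZ => //; rewrite invr_ge0 ltW.
apply: nNw; have -> : - w = (- t)^-1 *: (t *: w).
  by rewrite scalerA invrN mulNr mulVf ?scaleN1r // ltr0_neq0.
by apply: sZ => //; rewrite invr_ge0 oppr_ge0 ltW.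
Qed.

Lemma no_positive_relation x1 x2 x3 (a1 a2 a3 t : R) :
  s x1 -> s x2 -> s x3 -> x1 != 0 -> x2 != 0 -> x3 != 0 ->
  0 <= a1 -> 0 <= a2 -> 0 <= a3 -> a1 *: x1 + a2 *: x2 + a3 *: x3 = t *: w ->
  [/\ a1 = 0, a2 = 0 & a3 = 0].
Proof.
have [_ sD sZ] := cs.
move=> s1 s2 s3 n1 n2 n3 p1 p2 p3 e.
have q1 := sZ _ _ p1 s1; have q2 := sZ _ _ p2 s2; have q3 := sZ _ _ p3 s3.
have t0 : t = 0 by apply: notin_line; rewrite -e; apply: (sD); [apply: (sD)|].
rewrite t0 scale0r in e.
have z3 : a3 *: x3 = 0.
  by apply: (pointed_addr_eq0 ps q3 (sD _ _ q1 q2)); rewrite addrC.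
rewrite z3 addr0 in e.
have z1 := pointed_addr_eq0 ps q1 q2 e.
rewrite z1 add0r in e.
move/eqP: e; move/eqP: z1; move/eqP: z3; rewrite !scaler_eq0.
by rewrite (negPf n1) (negPf n2) (negPf n3) !orbF => /eqP-> /eqP-> /eqP->.
Qed.

(** Solve for the vector with the negative coefficient.  If [t <> 0], a
    translate of it along [w] is in [s], against the silhouette property; if
    [t = 0], it is a combination of two vectors of [s] off its face [r2]. *)
Lemma no_mixed_relation r2 x1 x2 x3 (a1 a2 a3 t : R) :
  is_face r2 s -> r2 x2 -> s x1 -> s x3 -> x2 != 0 -> ~ r2 x1 -> ~ r2 x3 ->
  silhouette w s x2 -> 0 <= a1 -> a2 < 0 -> 0 <= a3 ->
  a1 *: x1 + a2 *: x2 + a3 *: x3 = t *: w -> False.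
Proof.
have [_ sD sZ] := cs.
move=> [u u0 r2E] r2x s1 s3 n2 d1 d3 sil p1 a20 p3 e.
have e' : a1 *: x1 + a3 *: x3 = (- a2) *: x2 + t *: w.
  by rewrite -e scaleNr [a1 *: x1 + a2 *: x2]addrC -addrA addKr.
have q : s (a1 *: x1 + a3 *: x3) by apply: sD; exact: sZ.
have na2 : 0 < - a2 by rewrite oppr_gt0.
have [t0|t0] := eqVneq t 0; last first.
  apply: (sil (t / (- a2))); first by rewrite mulf_neq0 // invr_neq0 // gt_eqF.
  have -> : x2 + (t / (- a2)) *: w = (- a2)^-1 *: (a1 *: x1 + a3 *: x3).
    by rewrite e' scalerDr !scalerA mulVf ?gt_eqF // scale1r mulrC.
  by apply: sZ => //; rewrite invr_ge0 ltW.
rewrite t0 scale0r addr0 in e'.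
have ux2 : u x2 = 0 by move: r2x; rewrite r2E => -[].
have ue : a1 * u x1 + a3 * u x3 = 0 by rewrite -!formZ -formD e' formZ ux2 mulr0.
have g1 := u0 _ s1; have g3 := u0 _ s3.
have m1 : 0 <= a1 * u x1 by exact: mulr_ge0.
have m3 : 0 <= a3 * u x3 by exact: mulr_ge0.
have z1 : a1 = 0.
  have /eqP : a1 * u x1 = 0 by lra.
  rewrite mulf_eq0 => /orP[/eqP//|/eqP ux]; case: d1; rewrite r2E; split=> //.
have z3 : a3 = 0.
  have /eqP : a3 * u x3 = 0 by lra.
  rewrite mulf_eq0 => /orP[/eqP//|/eqP ux]; case: d3; rewrite r2E; split=> //.
move/eqP: e'; rewrite z1 z3 !scale0r addr0 eq_sym scaler_eq0 (negPf n2) orbF.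
by rewrite gt_eqF.
Qed.

End Silhouette.

Section Fan3.
Variables (R : realType) (N : zmodType) (V : vectType R) (iota : {additive N -> V}).
Local Notation form := {linear V -> R^o}.
Implicit Types (u : form) (x y z w p n : V) (s t r : set V).
Variables (c : 'I_3 -> form) (B : 'I_3 -> V).
Hypothesis cB : forall k j, c k (B j) = (k == j)%:R.
Hypothesis Bc : forall x, x = \sum_k c k x *: B k.
Variable D : set (set V).
Hypothesis fanD : is_fan iota D.
Hypothesis coverD : fan_support D = setT.

(** By Cramer's rule when the three vectors are independent; otherwise they
    satisfy a relation by themselves, and [t = 0]. *)
Lemma linear_relation x1 x2 x3 w : w != 0 -> x1 != 0 -> (forall a : R, x2 <> a *: x1) ->
  exists a1 a2 a3 t : R, a1 *: x1 + a2 *: x2 + a3 *: x3 = t *: w /\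
    ~ [/\ a1 = 0, a2 = 0 & a3 = 0].
Proof.
move=> w0 n1 n2; have [d0|d0] := eqVneq (det3 c x1 x2 x3) 0.
  have [a [b e]] := det0_span cB Bc n1 n2 d0.
  exists a, b, (-1), 0; rewrite e scaleN1r subrr scale0r; split=> // -[_ _].
  by move/eqP; rewrite oppr_eq0 oner_eq0.
exists (det3 c w x2 x3), (det3 c x1 w x3), (det3 c x1 x2 w), (det3 c x1 x2 x3).
split; first exact/esym/(cramer Bc).
move=> [z1 z2 z3]; have := cramer Bc x1 x2 x3 w.
rewrite z1 z2 z3 !scale0r !addr0 => /eqP.
by rewrite scaler_eq0 (negPf d0) (negPf w0).
Qed.

Variable g : set V -> N.
Hypothesis gP : forall r, fan_cones D 1 r ->
  iota (g r) != 0 /\ r = conic [:: iota (g r)].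
Local Notation v r := (iota (g r)).

Lemma ray_mem r : fan_cones D 1 r -> r (v r).
Proof.
by move=> /gP[_ e]; rewrite {1}e; apply/conic1P; exists 1; rewrite ?scale1r.
Qed.

Lemma ray_inj r r' : fan_cones D 1 r -> fan_cones D 1 r' -> r' (v r) -> r = r'.
Proof.
move=> hr hr' h; have [n0 e] := gP hr; have [_ e'] := gP hr'.
by rewrite e e'; apply: ray_eq => //; rewrite -e'.
Qed.

Lemma ray_indep s r r' : D s -> fan_cones D 1 r -> fan_cones D 1 r' ->
  r `<=` s -> r' `<=` s -> r <> r' -> forall a : R, v r' <> a *: v r.
Proof.
move=> Ds hr hr' rs rs' ne a e.
have [n0 re] := gP hr; have [n0' re'] := gP hr'.
have [a0|a0] := leP 0 a.
  by apply/ne/esym/ray_inj => //; rewrite re; apply/conic1P; exists a.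
have [_ _ sZ] := fan_cone fanD Ds.
move/eqP: n0'; apply; apply: (fan_pointed fanD Ds); first exact: rs' (ray_mem hr').
by rewrite e -scaleNr; apply: sZ; [rewrite oppr_ge0 ltW|exact: rs (ray_mem hr)].
Qed.

(** Three vectors and [w] are linearly dependent in dimension three.  Up to a
    global sign, the coefficients of the three vectors are nonnegative, or
    exactly one is negative; [no_positive_relation] and
    [no_mixed_relation] exclude these cases. *)
Lemma silhouette_le2 w s r1 r2 r3 : D s -> ~ s w -> ~ s (- w) ->
  fan_cones D 1 r1 -> fan_cones D 1 r2 -> fan_cones D 1 r3 ->
  r1 `<=` s -> r2 `<=` s -> r3 `<=` s ->
  silhouette w s (v r1) -> silhouette w s (v r2) -> silhouette w s (v r3) ->
  r1 <> r2 -> r2 <> r3 -> r3 <> r1 -> False.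
Proof.
move=> Ds nw nNw h1 h2 h3 rs1 rs2 rs3 sil1 sil2 sil3 n12 n23 n31.
have cs := fan_cone fanD Ds; have ps := fan_pointed fanD Ds.
have w0 : w != 0 by apply/eqP => w0; apply: nw; rewrite w0; case: cs.
have [z1 _] := gP h1; have [z2 _] := gP h2; have [z3 _] := gP h3.
have m1 := ray_mem h1; have m2 := ray_mem h2; have m3 := ray_mem h3.
have s1 := rs1 _ m1; have s2 := rs2 _ m2; have s3 := rs3 _ m3.
have f1 := fan_face fanD Ds h1.1 rs1.
have f2 := fan_face fanD Ds h2.1 rs2.
have f3 := fan_face fanD Ds h3.1 rs3.
have mid a1 a2 a3 (t : R) := @no_mixed_relation R V w s cs r2 (v r1) (v r2) (v r3)
  a1 a2 a3 t f2 m2 s1 s3 z2 (fun h => n12 (ray_inj h1 h2 h))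
  (fun h => n23 (esym (ray_inj h3 h2 h))) sil2.
have left a1 a2 a3 (t : R) := @no_mixed_relation R V w s cs r1 (v r2) (v r1) (v r3)
  a1 a2 a3 t f1 m1 s2 s3 z1 (fun h => n12 (esym (ray_inj h2 h1 h)))
  (fun h => n31 (ray_inj h3 h1 h)) sil1.
have right a1 a2 a3 (t : R) := @no_mixed_relation R V w s cs r3 (v r1) (v r3) (v r2)
  a1 a2 a3 t f3 m3 s1 s2 z3 (fun h => n31 (esym (ray_inj h1 h3 h)))
  (fun h => n23 (ray_inj h2 h3 h)) sil3.
have key (a1 a2 a3 t : R) : a1 *: v r1 + a2 *: v r2 + a3 *: v r3 = t *: w ->
    [/\ a1 = 0, a2 = 0 & a3 = 0] \/ a1 < 0 /\ (a2 < 0 \/ a3 < 0) \/ a2 < 0 /\ a3 < 0.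
  move=> e; have [p1|p1] := leP 0 a1; have [p2|p2] := leP 0 a2;
    have [p3|p3] := leP 0 a3; auto.
  - by left; apply: (no_positive_relation cs ps nw nNw s1 s2 s3 _ _ _ _ _ _ e).
  - by case: (right a1 a3 a2 t) => //; rewrite addrAC.
  - by case: (mid a1 a2 a3 t).
  - by case: (left a2 a1 a3 t) => //; rewrite [a2 *: _ + _]addrC.
have [a1 [a2 [a3 [t [e ne]]]]] :=
  linear_relation (v r3) w0 z1 (ray_indep Ds h1 h2 rs1 rs2 n12).
have e' : (- a1) *: v r1 + (- a2) *: v r2 + (- a3) *: v r3 = (- t) *: w.
  by rewrite !scaleNr -e !opprD.
have [//|q] := key _ _ _ _ e.
have [[/eqP q1 /eqP q2 /eqP q3]|q'] := key _ _ _ _ e'.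
  by apply: ne; rewrite !oppr_eq0 in q1 q2 q3; rewrite (eqP q1) (eqP q2) (eqP q3).
exact: two_signs q q'.
Qed.

Lemma plane_basis r t : fan_cones D 1 r -> fan_cones D 2 t -> r `<=` t ->
  exists y, [/\ t y, forall a : R, y <> a *: v r
    & forall z, t z -> exists a b : R, z = a *: v r + b *: y].
Proof.
move=> hr [Dt [U [tU Umin dU]]] rt; have [n0 _] := gP hr.
have xU : v r \in U by apply: tU; exact: rt (ray_mem hr).
have [y [ty yx]] : exists y, t y /\ y \notin <[v r]>%VS.
  apply: contrapT => h.
  have /dimvS : (U <= <[v r]>)%VS.
    by apply: Umin => y ty /=; apply: contrapT => /negP ny; apply: h; exists y.
  by rewrite dU dim_vline n0.
exists y; split=> // [a e|z tz].
  by move/negP: yx; apply; apply/vlineP; exists a.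
have UE : (<[v r]> + <[y]>)%VS = U.
  apply/eqP; rewrite eqEdim subv_add -!memvE xU (tU _ ty) /=.
  have /dimv_disjoint_sum -> : (<[v r]> :&: <[y]> = 0)%VS.
    apply/eqP; rewrite -subv0; apply/subvP => x /memv_capP[xv /vlineP[b xb]].
    have [b0|b0] := eqVneq b 0; first by rewrite xb b0 scale0r mem0v.
    by case/negP: yx; rewrite -[y]scale1r -(mulVf b0) -scalerA -xb memvZ.
  by rewrite dU !dim_vline n0 /=; case: eqP yx => // ->; rewrite mem0v.
have : z \in (<[v r]> + <[y]>)%VS by rewrite UE; exact: tU.
by move=> /memv_addP[_ /vlineP[a ->] [_ /vlineP[b ->] ->]]; exists a, b.
Qed.

(** Push a relative interior point [p] of [t] towards the positive side of the
    plane of [t], and take the cone [s] met there.  It contains [t] as a face, so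
    [t] has a supporting form on [s]; that form and [det3 c (v r) y] have the
    same kernel, the plane of [t], and the same sign at [n]. *)
Lemma left_cone r t : fan_cones D 1 r -> fan_cones D 2 t -> r `<=` t ->
  exists s y, [/\ D s /\ full s, t `<=` s, t y /\ forall a : R, y <> a *: v r,
    forall z, t z -> exists a b : R, z = a *: v r + b *: y
    & forall z, s z -> 0 <= det3 c (v r) y z].
Proof.
move=> hr ht rt; have [y [ty yx tspan]] := plane_basis hr ht rt.
have Dt := ht.1; have [x0 _] := gP hr; have tx := rt _ (ray_mem hr).
have [n n0] := det_pos cB Bc x0 yx.
have [p tp pmin] := fan_relint fanD Dt.
have [s [e [Ds sp e0 spe]]] := fan_cover_direction fanD p n coverD.
have ts : t `<=` s := pmin _ Ds sp.
have detp : det3 c (v r) y p = 0.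
  by have [a [b ->]] := tspan _ tp; exact: det3_span.
have detu (u : form) z : u (v r) = 0 -> u y = 0 ->
    det3 c (v r) y n * u z = det3 c (v r) y z * u n.
  by move=> ux uy; rewrite -!formZ (cramer Bc) !formD !formZ ux uy !mulr0 !add0r.
have [ud hud] := det_form c (v r) y.
exists s, y; split=> //.
  split=> // u us z; have ux := us _ (ts _ tx); have uy := us _ (ts _ ty).
  have un : u n = 0.
    have := us _ spe; rewrite formD formZ us // add0r => /eqP.
    by rewrite mulf_eq0 gt_eqF //= => /eqP.
  have := detu u z ux uy; rewrite un mulr0 => /eqP.
  by rewrite mulf_eq0 gt_eqF //= => /eqP.
have [u u0 tE] := fan_face fanD Ds Dt ts.
have ut z : t z -> u z = 0 by rewrite tE => -[].
have un : 0 < u n.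
  have upe : 0 < u (p + e *: n).
    rewrite lt_def u0 // andbT; apply/eqP => ue.
    have : t (p + e *: n) by rewrite tE.
    move=> /tspan[a [b eab]]; have := det3_span c (v r) y a b.
    rewrite -eab -hud formD formZ !hud detp add0r => /eqP.
    by rewrite mulf_eq0 !gt_eqF.
  by move: upe; rewrite formD formZ ut // add0r pmulr_rgt0.
move=> z sz; rewrite -(pmulr_lge0 _ un) -(detu u z (ut _ tx) (ut _ ty)).
by rewrite mulr_ge0 ?u0 // ltW.
Qed.

(** Each of [y], [y'] lies on the nonnegative side of the plane spanned by the
    other one and [v r], and the determinant is alternating, so both planes
    coincide; a face of [s] contains every vector of [s] lying in its plane. *)
Lemma left_cone_inj r s t t' y y' : fan_cones D 1 r -> D s -> D t -> D t' ->
  r `<=` t -> r `<=` t' -> t `<=` s -> t' `<=` s ->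
  t y -> (forall a : R, y <> a *: v r) -> t' y' -> (forall a : R, y' <> a *: v r) ->
  (forall z, t z -> exists a b : R, z = a *: v r + b *: y) ->
  (forall z, t' z -> exists a b : R, z = a *: v r + b *: y') ->
  (forall z, s z -> 0 <= det3 c (v r) y z) ->
  (forall z, s z -> 0 <= det3 c (v r) y' z) -> t = t'.
Proof.
suff half t1 t2 y1 y2 : fan_cones D 1 r -> D s -> D t1 -> D t2 ->
  r `<=` t1 -> t1 `<=` s -> t2 `<=` s ->
  t1 y1 -> (forall a : R, y1 <> a *: v r) -> t2 y2 ->
  (forall z, t2 z -> exists a b : R, z = a *: v r + b *: y2) ->
  (forall z, s z -> 0 <= det3 c (v r) y1 z) ->
  (forall z, s z -> 0 <= det3 c (v r) y2 z) -> t2 `<=` t1.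
  move=> *; apply/seteqP; split; [apply: (half t' t y' y)|apply: (half t t' y y')] => //.
move=> hr Ds D1 D2 r1 t1s t2s ty1 n1 ty2 span2 h1 h2.
have [x0 _] := gP hr.
have d0 : det3 c (v r) y1 y2 = 0.
  apply/eqP; rewrite eq_le h1 ?andbT; last exact: t2s.
  by rewrite -oppr_ge0 -det3C; apply/h2/t1s.
have [a [b e]] := det0_span cB Bc x0 n1 d0.
have [u u0 t1E] := fan_face fanD Ds D1 t1s.
have ut z : t1 z -> u z = 0 by rewrite t1E => -[].
move=> z t2z; rewrite t1E; split; first exact: t2s.
have [a' [b' ->]] := span2 _ t2z.
rewrite /= e !(formD, formZ) (ut _ (r1 _ (ray_mem hr))) (ut _ ty1).
by rewrite !(mulr0, addr0).
Qed.

End Fan3.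

(** * Linear systems and counting *)

Section MoreUnknowns.
Variables (K : fieldType) (I J : finType).
Lemma homogeneous_solution (L : {linear {ffun I -> K^o} -> {ffun J -> K^o}}) :
  (#|J| < #|I|)%N -> exists2 x, x != 0 & L x = 0.
Proof.
move=> lt.
have [h|h] := eqVneq (lker (linfun L)) 0%VS; last first.
  exists (vpick (lker (linfun L))); first by rewrite vpick0.
  by have := memv_pick (lker (linfun L)); rewrite memv_ker lfunE => /eqP.
have := limg_ker_dim (linfun L) fullv; rewrite h capv0 dimv0 add0n => e.
have := dimvS (subvf (limg (linfun L))); rewrite e !dimvf.
rewrite /dim /= !muln1.
by rewrite leqNgt lt.
Qed.
End MoreUnknowns.

Lemma finite_enum (T : eqType) (A : set T) : finite_set A ->
  exists n (f : 'I_n -> T), injective f /\ forall x, A x <-> exists i, f i = x.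
Proof.
move=> /finite_seqP[s ->]; exists (size (undup s)), (tnth (in_tuple (undup s))).
split.
  exact/tuple_uniqP/undup_uniq.
move=> x /=; rewrite -mem_undup; split=> [xs|[i <-]]; last exact: mem_tnth.
by have /tnthP[i ->] : x \in in_tuple (undup s) by []; exists i.
Qed.

Lemma sum_bool_card (T : finType) (P : pred T) : (\sum_x P x = #|[pred x | P x]|)%N.
Proof.
by rewrite -sum1_card [RHS]big_mkcond; apply: eq_bigr => x _; rewrite inE; case: (P x).
Qed.

Lemma sum_le1 (T : finType) (P : pred T) :
  (forall x y, P x -> P y -> x = y) -> (\sum_x P x <= 1)%N.
Proof.
move=> h; rewrite sum_bool_card.
rewrite leqNgt; apply/negP => /card_gt1P[x [y []]].
by rewrite !inE => px py /eqP[]; exact: h.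
Qed.

(** The arithmetic of the double counting.  [F] stands for the full cones and [Q]
    for the rays; [pos] and [neg] say that the ray enters the cone along [w],
    respectively [- w]; [fp] and [fn] are the cones containing [w] and [- w]. *)
Lemma incidence_count (F Q : finType) (inc pos neg : F -> Q -> bool) (fp fn : F) :
  fp != fn ->
  (forall r, 4 <= \sum_f inc f r)%N ->
  (forall r f f', inc f r && pos f r -> inc f' r && pos f' r -> f = f') ->
  (forall r f f', inc f r && neg f r -> inc f' r && neg f' r -> f = f') ->
  (forall f r1 r2 r3, [/\ inc f r1, ~~ pos f r1 & ~~ neg f r1] ->
     [/\ inc f r2, ~~ pos f r2 & ~~ neg f r2] ->
     [/\ inc f r3, ~~ pos f r3 & ~~ neg f r3] ->
     r1 != r2 -> r2 != r3 -> r3 != r1 -> False) ->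
  (forall r, inc fp r -> pos fp r) -> (forall r, inc fn r -> neg fn r) ->
  (#|[pred p : F * Q | inc p.1 p.2]| + 6 <= 3 * #|F| + #|Q|)%N.
Proof.
move=> fpn h4 hpos hneg hmix hfp hfn.
pose mix f r := [&& inc f r, ~~ pos f r & ~~ neg f r].
have SE : #|[pred p : F * Q | inc p.1 p.2]| = (\sum_f \sum_r inc f r)%N.
  by rewrite pair_big /= -sum_bool_card.
have S4 : (4 * #|Q| <= \sum_f \sum_r inc f r)%N.
  rewrite exchange_big /= mulnC -sum_nat_const; apply: leq_sum => r _; exact: h4.
have Smix : (\sum_f \sum_r inc f r <=
    \sum_f \sum_r (inc f r && pos f r) + \sum_f \sum_r (inc f r && neg f r)
    + \sum_f \sum_r mix f r)%N.
  rewrite -!big_split /=; apply: leq_sum => f _.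
  rewrite -!big_split /=; apply: leq_sum => r _.
  by rewrite /mix; case: (inc f r); case: (pos f r); case: (neg f r).
have bound (p : F -> Q -> bool) :
    (forall r f f', inc f r && p f r -> inc f' r && p f' r -> f = f') ->
    (\sum_f \sum_r (inc f r && p f r) <= #|Q|)%N.
  move=> hp; rewrite exchange_big /= -sum1_card; apply: leq_sum => r _.
  exact/sum_le1/hp.
have mix2 f : (\sum_r mix f r <= 2)%N.
  rewrite sum_bool_card leqNgt; apply/negP => /card_gt2P[r1 [r2 [r3 [[]]]]].
  rewrite !inE => /and3P h1 /and3P h2 /and3P h3 [n12 n23 n31].
  exact: hmix h1 h2 h3 n12 n23 n31.
have mix0 f : (forall r, inc f r -> pos f r || neg f r) -> (\sum_r mix f r = 0)%N.
  move=> h; apply: big1 => r _; rewrite /mix; have := h r.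
  by case: (inc f r) => //= /(_ isT); case: (pos f r); case: (neg f r).
have Smix2 : (\sum_f \sum_r mix f r + 4 <= 2 * #|F|)%N.
  rewrite (bigD1 fp) //= (bigD1 fn) /=; last by rewrite eq_sym.
  rewrite !mix0; last 2 first.
  - by move=> r /hfn ->; rewrite orbT.
  - by move=> r /hfp ->.
  rewrite !add0n mulnC -sum_nat_const [X in (_ <= X)%N](bigD1 fp) //=.
  rewrite [X in (_ <= _ + X)%N](bigD1 fn) /=; last by rewrite eq_sym.
  rewrite addnA addnC leq_add2l; apply: leq_sum => f _; exact: mix2.
have bp := bound pos hpos; have bn := bound neg hneg.
rewrite SE; move: S4 Smix Smix2 bp bn; lia.
Qed.
(** * Existence of a nontrivial conewise linear function *)

Lemma clear_denominators (I : finType) (x : I -> rat) :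
  exists (d : int) (y : I -> int),
    d != 0 /\ forall i, (y i)%:~R = d%:~R * x i :> rat.
Proof.
exists (\prod_i denq (x i)), (fun i => numq (x i) * \prod_(j | j != i) denq (x j)).
split; first by apply/prodf_neq0 => i _; exact: denq_neq0.
move=> i; rewrite [in RHS](bigD1 i) //= !intrM numqE; ring.
Qed.

(** The unknowns are [m] and [h]; the [n] equations [m f0 = 0] remove the
    solutions in which all [m f] are equal. *)
Lemma integral_solution (F Q : finType) (n : nat) (inc : F -> Q -> bool)
    (a : Q -> 'I_n -> int) (f0 : F) :
  (#|[pred p : F * Q | inc p.1 p.2]| + n < n * #|F| + #|Q|)%N ->
  exists (m : F -> 'I_n -> int) (h : Q -> int),
    [/\ forall f r, inc f r -> \sum_k m f k * a r k = h r,
        forall k, m f0 k = 0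
      & ~ ((forall f k, m f k = 0) /\ forall r, h r = 0)].
Proof.
move=> lt.
pose I : finType := (F * 'I_n + Q)%type.
pose J : finType := ({p : F * Q | inc p.1 p.2} + 'I_n)%type.
have cI : #|I| = (n * #|F| + #|Q|)%N by rewrite card_sum card_prod card_ord mulnC.
have cJ : #|J| = (#|[pred p : F * Q | inc p.1 p.2]| + n)%N.
  by rewrite card_sum card_sig card_ord.
pose l (x : {ffun I -> rat^o}) : {ffun J -> rat^o} := [ffun j => match j with
  | inl p => \sum_k x (inl ((val p).1, k)) * (a (val p).2 k)%:~R - x (inr (val p).2)
  | inr k => x (inl (f0, k)) end].
have ll : linear l.
  move=> b x y; apply/ffunP => -[p|k]; rewrite !ffunE //.
  have -> : \sum_k (b *: x + y) (inl ((val p).1, k)) * (a (val p).2 k)%:~R =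
      b * \sum_k x (inl ((val p).1, k)) * (a (val p).2 k)%:~R
      + \sum_k y (inl ((val p).1, k)) * (a (val p).2 k)%:~R :> rat.
    rewrite mulr_sumr -big_split; apply: eq_bigr => k _.
    by rewrite !ffunE mulrDl mulrA.
  by rewrite opprD addrACA scalerBr.
pose L : {linear {ffun I -> rat^o} -> {ffun J -> rat^o}} :=
  HB.pack l (GRing.isLinear.Build rat {ffun I -> rat^o} {ffun J -> rat^o} *:%R l ll).
have [|x x0 Lx] := @homogeneous_solution _ _ _ L; first by rewrite cI cJ.
have {}Lx j : l x j = 0.
  by have := congr1 (fun z : {ffun J -> rat^o} => z j) Lx; rewrite !ffunE.
have [d [y [d0 hy]]] := clear_denominators x.
have dQ : (d%:~R : rat) != 0 by rewrite intr_eq0.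
exists (fun f k => y (inl (f, k))), (fun r => y (inr r)); split.
- move=> f r fr; apply/eqP; rewrite -(eqr_int rat) -subr_eq0.
  have := Lx (inl (exist _ (f, r) fr)); rewrite ffunE /= => e.
  rewrite raddf_sum hy /=.
  under eq_bigr => k _ do rewrite intrM hy -mulrA.
  by rewrite -mulr_sumr -mulrBr e mulr0.
- move=> k; have := Lx (inr k); rewrite ffunE => e.
  by apply/eqP; rewrite -(eqr_int rat) hy e mulr0.
- move=> [hm hh]; move/eqP: x0; apply; apply/ffunP => i; rewrite ffunE.
  apply: (mulfI dQ); rewrite mulr0 -hy.
  by case: i => [[f k]|r]; rewrite ?hm ?hh.
Qed.

Section Main.
Variables (R : realType) (N : zmodType) (V : vectType R) (iota : {additive N -> V}).
Local Notation form := {linear V -> R^o}.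
Variables (e : 'I_3 -> {additive N -> int}) (c : 'I_3 -> form) (B : 'I_3 -> V).
Hypothesis ce : forall k x, c k (iota x) = (e k x)%:~R.
Hypothesis cB : forall k j, c k (B j) = (k == j)%:R.
Hypothesis Bc : forall x, x = \sum_k c k x *: B k.
Variable D : set (set V).
Hypothesis fanD : is_fan iota D.
Hypothesis coverD : fan_support D = setT.
Hypothesis rays4 : forall r, fan_cones D 1 r ->
  (`I_4 #<= [set t | fan_cones D 2 t /\ r `<=` t])%card.

Lemma integral_form (m : 'I_3 -> int) : exists2 u : form, given_by_M iota u &
  forall x, u x = \sum_k (m k)%:~R * c k x.
Proof.
have [|u hu] := @ex_form R V (fun x => \sum_k (m k)%:~R * c k x).
  move=> a x y; rewrite mulr_sumr -big_split /=; apply: eq_bigr => k _.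
  by rewrite formD formZ; ring.
have hB : {morph (fun x => \sum_k m k * e k x) : x y / x - y}.
  move=> x y; rewrite -sumrB; apply: eq_bigr => k _.
  by rewrite raddfB mulrBr.
pose mu : {additive N -> int} := HB.pack (fun x => \sum_k m k * e k x)
  (GRing.isZmodMorphism.Build N int _ hB).
exists u => //; exists mu => x; rewrite hu [RHS]rmorph_sum; apply: eq_bigr => k _.
by rewrite /= intrM ce.
Qed.

Variable g : set V -> N.
Hypothesis gP : forall r, fan_cones D 1 r ->
  iota (g r) != 0 /\ r = conic [:: iota (g r)].
Local Notation v r := (iota (g r)).

Variables (nF nQ : nat) (fc : 'I_nF -> set V) (rc : 'I_nQ -> set V).
Hypotheses (fc_inj : injective fc) (rc_inj : injective rc).
Hypothesis fcP : forall s, D s /\ full s <-> exists i, fc i = s.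
Hypothesis rcP : forall r, fan_cones D 1 r <-> exists i, rc i = r.

Let inc (i : 'I_nF) (q : 'I_nQ) : bool := `[< rc q `<=` fc i >].

Let fcD i : D (fc i) /\ full (fc i).
Proof. by apply/fcP; exists i. Qed.

Let rcD q : fan_cones D 1 (rc q).
Proof. by apply/rcP; exists q. Qed.

Lemma valence_ge4 q : (4 <= \sum_i inc i q)%N.
Proof.
have /pcard_leP[phi] := rays4 (rcD q).
have phiP (i : 'I_4) : fan_cones D 2 (phi i) /\ rc q `<=` phi i.
  by have := @funS _ _ _ _ phi (nat_of_ord i) (ltn_ord i).
have /choice[s hs] i := left_cone cB Bc fanD coverD gP (rcD q) (phiP i).1 (phiP i).2.
have /choice[j hj] i : exists j, fc j = s i.
  by apply/fcP; have [y []] := hs i.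
rewrite sum_bool_card -[4%N]card_ord -(@card_imset _ _ j).
  apply/subset_leq_card/fintype.subsetP => _ /imsetP[i _ ->]; rewrite inE /inc.
  have [y [_ ts _ _ _]] := hs i.
  by rewrite hj => x /(phiP i).2 /ts.
move=> i i' jj; have ss : s i = s i' by rewrite -!hj jj.
have [y [[Ds _] ts [ty ny] span det]] := hs i.
have [y' [_ ts' [ty' ny'] span' det']] := hs i'.
rewrite -ss in ts' det'.
have : phi i = phi i'.
  apply: (left_cone_inj cB Bc fanD gP (rcD q) Ds (phiP i).1.1 (phiP i').1.1
    (phiP i).2 (phiP i').2 ts ts' ty ny ty' ny' span span' det det').
move=> /(@inj _ _ _ phi) h; apply: val_inj; apply: h; rewrite inE /=; exact: ltn_ord.
Qed.

Lemma incidences : (exists i : 'I_nF, True) /\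
  (#|[pred p : 'I_nF * 'I_nQ | inc p.1 p.2]| + 6 <= 3 * nF + nQ)%N.
Proof.
have [fin _ _ _] := fanD.
(* Treating the origin as one more cone forces [w != 0]. *)
have [|w gw0] := @generic_exists R V (D `|` [set [set 0]]).
  by rewrite finite_setU; split=> //; exact: finite_set1.
have gw : generic D w by move=> s Ds; apply: gw0; left.
have w0 : w != 0.
  have [|f0|u _] := gw0 [set 0]; first by right.
    have := f0 (c ord0) _ (B ord0); rewrite cB eqxx => h.
    have /eqP := h (fun x (x0 : x = 0) => etrans (congr1 _ x0) (linear0 _)).
    by rewrite oner_eq0.
  by apply: contraNneq => ->; rewrite linear0.
have gNw := genericN gw.
have full_at z : generic D z -> exists i, fc i z.
  move=> gz; have : fan_support D z by rewrite coverD.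
  move=> [s Ds sz]; have [s0 _ _] := fan_cone fanD Ds.
  have /fcP[i si] : D s /\ full s.
    split=> //; apply: (generic_full (e := 1) gz Ds s0); rewrite ?oner_neq0 //.
    by rewrite add0r scale1r.
  by exists i; rewrite si.
have [fp hfp] := full_at w gw; have [fn hfn] := full_at _ gNw.
have nz i x : fc i x -> fc i (- x) -> x = 0.
  by apply: (fan_pointed fanD); case: (fcD i).
have fpn : fp != fn.
  by apply: contra_neq w0 => ep; apply: (nz fn) => //; rewrite -ep.
split; first by exists fp.
pose pos i q := `[< exists2 a : R, 0 < a & fc i (v (rc q) + a *: w) >].
pose neg i q := `[< exists2 a : R, 0 < a & fc i (v (rc q) + a *: - w) >].
have uniq_dir z (p := fun i q => `[< exists2 a : R, 0 < a & fc i (v (rc q) + a *: z) >]) :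
    generic D z -> forall q i i', inc i q && p i q -> inc i' q && p i' q -> i = i'.
  move=> gz q i i' /andP[/asboolP iq /asboolP[a a0 ha]].
  move=> /andP[/asboolP iq' /asboolP[b b0 hb]]; apply: fc_inj.
  have rq := ray_mem gP (rcD q).
  apply: (generic_cone_unique fanD gz _ _ _ _ a0 b0 ha hb).
  - by case: (fcD i).
  - by case: (fcD i').
  - exact: iq.
  - exact: iq'.
have inside i z q : fc i z -> inc i q -> exists2 a : R, 0 < a & fc i (v (rc q) + a *: z).
  move=> iz /asboolP iq; exists 1 => //; rewrite scale1r.
  have [_ hD _] := fan_cone fanD (fcD i).1; apply: (hD) => //.
  by apply: iq; exact: (ray_mem gP (rcD q)).
have := @incidence_count _ _ inc pos neg fp fn fpn valence_ge4 (uniq_dir w gw)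
  (uniq_dir _ gNw).
rewrite !card_ord; apply; last first.
- by move=> q iq; apply/asboolP; exact: inside iq.
- by move=> q iq; apply/asboolP; exact: inside iq.
have sil i q : [/\ inc i q, ~~ pos i q & ~~ neg i q] ->
    rc q `<=` fc i /\ silhouette w (fc i) (v (rc q)).
  move=> [/asboolP iq /asboolPn np /asboolPn nn]; split=> // a a0 h.
  have [ap|an|] := ltgtP 0 a; first by apply: np; exists a.
    by apply: nn; exists (- a); rewrite ?oppr_gt0 // scalerN scaleNr opprK.
  by move/esym/eqP; rewrite (negPf a0).
move=> i q1 q2 q3 h1 h2 h3 n12 n23 n31.
have [i1 s1] := sil _ _ h1; have [i2 s2] := sil _ _ h2; have [i3 s3] := sil _ _ h3.
have [_ /negP np /negP nn] := h1.
have rne q q' : q != q' -> rc q <> rc q' by move=> /eqP ne /rc_inj.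
have nw z : ~ (exists2 a : R, 0 < a & fc i (v (rc q1) + a *: z)) -> ~ fc i z.
  by move=> h iz; apply: h; apply: inside => //; case: h1.
apply: (silhouette_le2 cB Bc fanD gP (fcD i).1 _ _ (rcD q1) (rcD q2) (rcD q3)
   i1 i2 i3 s1 s2 s3 (rne _ _ n12) (rne _ _ n23) (rne _ _ n31)).
  by apply: nw => h; apply: np; apply/asboolP.
by apply: nw => h; apply: nn; apply/asboolP.
Qed.

Theorem nontrivial_exists : exists f : V -> R,
  integral_conewise_linear iota D f /\ ~ trivial_on D f.
Proof.
have [[f0 _] hinc] := incidences.
have [|m [h [hm m0 nz]]] :=
  @integral_solution _ _ 3 inc (fun q k => e k (g (rc q))) f0.
  by rewrite !card_ord; apply: leq_trans hinc; rewrite -addnS leq_add2l.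
have /choice[u hu] i : exists u : form, given_by_M iota u /\
    forall x, u x = \sum_k (m i k)%:~R * c k x.
  by have [u] := integral_form (m i); exists u.
have uE i q : inc i q -> u i (v (rc q)) = (h q)%:~R.
  move=> iq; rewrite (hu i).2 -(hm i q iq) [RHS]rmorph_sum; apply: eq_bigr => k _.
  by rewrite /= intrM ce.
have agree i j x : fc i x -> fc j x -> u i x = u j x.
  move=> ix jx; have [|d hd] := @ex_form R V (fun x => (u i x : R) - u j x).
    by move=> a y z; rewrite !(formD (u _)) !(formZ (u _)); ring.
  have : vanishes d (fc i `&` fc j).
    apply: (vanishes_on_rays fanD); first exact: (fanI fanD (fcD i).1 (fcD j).1).
    move=> r /rcP[q <-] sub x'; have [_ ->] := gP (rcD q).
    move=> /conic1P[a _ ->]; rewrite formZ hd !uE ?subrr ?mulr0 //.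
      by apply/asboolP => y /sub[].
    by apply/asboolP => y /sub[].
  by move=> /(_ x (conj ix jx)); rewrite hd => /eqP; rewrite subr_eq0 => /eqP.
pose f x : R := if pselect (exists i, fc i x) is left p then u (sval (cid p)) x else 0.
have fE i x : fc i x -> f x = u i x.
  move=> ix; rewrite /f; case: pselect => [p|[]]; last by exists i.
  by apply: agree => //; case: (cid p).
exists f; split.
  move=> s Ds; have [t [Dt ft st]] := fan_in_full fanD coverD Ds.
  have /fcP[i it] := conj Dt ft; exists (u i); first exact: (hu i).1.
  by move=> x sx; apply: fE; rewrite it; exact: st.
move=> [l hl].
have lE i x : fc i x -> u i x = l x.
  by move=> ix; rewrite -(fE i x ix); apply: hl; exists (fc i) => //; case: (fcD i).
(* A global form inducing [f] vanishes on the full cone [fc f0], hence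
   everywhere, and then all the unknowns vanish. *)
have l0 x : l x = 0.
  apply: (fcD f0).2 => y fy; rewrite -(lE f0 y fy) (hu f0).2 big1 // => k _.
  by rewrite m0 mul0r.
have mz i k : m i k = 0.
  have : u i (B k) = 0 by apply: (fcD i).2 => y fy; rewrite lE.
  rewrite (hu i).2 (bigD1 k) //= cB eqxx mulr1 big1 ?addr0 => [/eqP|j /negPf jk].
    by rewrite intr_eq0 => /eqP.
  by rewrite cB jk mulr0.
apply: nz; split=> // q.
have [t [Dt ft st]] := fan_in_full fanD coverD (rcD q).1.
have /fcP[i it] := conj Dt ft.
rewrite -(hm i q); first by rewrite big1 // => k _; rewrite mz mul0r.
by apply/asboolP; rewrite it.
Qed.

End Main.

Theorem lemma3p2 (R : realType) (N : zmodType) (hN : free_of_rank N 3)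
    (NR : vectType R) (iota : {additive N -> NR})
    (hNR : is_realification iota)
    (Delta : set (set NR)) (hDelta : complete_fan iota Delta)
    (hrays : forall rho, fan_cones Delta 1 rho ->
       (`I_4 #<= [set tau | fan_cones Delta 2 tau /\ rho `<=` tau])%card) :
  exists f : NR -> R,
    integral_conewise_linear iota Delta f /\ ~ trivial_on Delta f.
Proof.
have [fanD coverD] := hDelta; have [fin _ _ _] := fanD.
have [e [c [B [ce cB Bc]]]] := lattice_coordinates hN hNR.
have /choice[g gP] r : exists n : N, fan_cones Delta 1 r ->
    iota n != 0 /\ r = conic [:: iota n].
  have [hr|nr] := pselect (fan_cones Delta 1 r); last by exists 0.
  by have [n n0 rn] := ray_gen fanD hr; exists n.
have [|nF [fc [fc_inj fcP]]] := @finite_enum _ [set s | Delta s /\ full s].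
  by apply: sub_finite_set fin => s [].
have [|nQ [rc [rc_inj rcP]]] := @finite_enum _ (fan_cones Delta 1).
  by apply: sub_finite_set fin => s [].
exact: (nontrivial_exists ce cB Bc fanD coverD hrays gP fc_inj rc_inj fcP rcP).
Qed.
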